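(* Let $\tau\in\mathbb{C}$ with $\mathrm{Im}\,\tau>0$, let $\kappa\in\mathbb{C}$ with $\kappa\notin\mathbb{Z}+\tau\mathbb{Z}$, and let $\beta\in\mathbb{C}$. There is no nonzero finite dimensional $\mathbb{C}$-linear subspace of $\mathcal{M}(\mathbb{C}^2)$ that is invariant under the operators $\mathcal{R}^e_{0,\beta}(\lambda)$ for all $\lambda\in\mathbb{C}\setminus(\mathbb{Z}+\tau\mathbb{Z})$.
   Context: $\mathcal{M}(\mathbb{C}^2)$ is the field of meromorphic functions on $\mathbb{C}^2$. Let $\theta(z)=\vartheta_1(z,\tau)=-\sum_{m\in\mathbb{Z}}\exp\{\pi i(m+\frac12)^2\tau+2\pi i(m+\frac12)(z+\frac12)\}$ be Jacobi's first theta function and $G(z,\lambda)=\dfrac{\theta'(0)\theta(z+\lambda)}{\theta(z)\theta(\lambda)}$. The twisted elliptic Shibukawa-Ueno operator $\mathcal{R}^e_{\alpha,\beta}(\lambda)$ acts on $f\in\mathcal{M}(\mathbb{C}^2)$ by $$\mathcal{R}^e_{\alpha,\beta}(\lambda)\cdot f(z_1,z_2)=G(z_1-z_2-2(\alpha\lambda+\beta),\lambda)\,f(z_2+2\alpha\lambda,z_1-2\alpha\lambda)-G(z_1-z_2-2(\alpha\lambda+\beta),\kappa)\,f(z_1-2\beta,z_2+2\beta),$$ so that for $\alpha=0$ $$\mathcal{R}^e_{0,\beta}(\lambda)\cdot f(z_1,z_2)=G(z_1-z_2-2\beta,\lambda)\,f(z_2,z_1)-G(z_1-z_2-2\beta,\kappa)\,f(z_1-2\beta,z_2+2\beta).$$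 *)

(* Defs.v *)
From HB Require Import structures.
From mathcomp Require Import all_boot all_order all_algebra.
From mathcomp Require Import complex.
From mathcomp Require Import all_classical all_reals all_analysis.

Set Implicit Arguments.
Unset Strict Implicit.
Unset Printing Implicit Defensive.

Import Order.TTheory GRing.Theory Num.Theory numFieldNormedType.Exports.

Local Open Scope classical_set_scope.
Local Open Scope ring_scope.

(* The complex numbers R[i], packed as a numFieldType: this is what gives them
   the topology of the modulus and makes [differentiable] and [derive1] mean
   complex differentiability. *)
Definition cplx (R : realType) : numFieldType := R[i]%C.

Section Defs.
Variable R : realType.
Local Notation C := (cplx R).
Local Notation C2 := (C * C)%type.

Implicit Types (tau kappa alpha beta lambda : C) (f g h : C2 -> C).

(** Meromorphic functions on C^2 *)

(* A meromorphic function is handled through its representatives: total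
   functions C2 -> C, with arbitrary values on a closed nowhere dense set
   (which absorbs poles and points of indeterminacy).  Two representatives of
   meromorphic functions define the same element of the field M(C^2) iff they
   agree on a dense open set. *)
Definition meq f g : Prop := dense [set z | f z = g z]°.

Definition holomorphic_on (U : set C2) g : Prop :=
  forall z, U z -> differentiable g z.

(* Locally a quotient g / h of holomorphic functions.  The last condition says
   that h != 0 and f = g / h on a dense open subset of U; in particular h does
   not vanish identically on any nonempty open subset of U. *)
Definition meromorphic f : Prop :=
  forall p : C2, exists (U : set C2) (g h : C2 -> C),
    [/\ open_nbhs p U, holomorphic_on U g, holomorphic_on U h
      & U `<=` closure [set z | h z != 0 /\ f z = g z / h z]°].

(* Complex linear subspaces of M(C^2), each given by the set of all the
   representatives of its elements. *)
Definition mero_subspace (V : set (C2 -> C)) : Prop :=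
  [/\ V `<=` meromorphic,
      forall f g, V f -> meq f g -> V g,
      V (fun=> 0)
    & forall (a : C) f g, V f -> V g -> V (fun z => a * f z + g z)].

Definition nonzero_subspace (V : set (C2 -> C)) : Prop :=
  exists2 f, V f & ~ meq f (fun=> 0).

Definition finite_dimensional (V : set (C2 -> C)) : Prop :=
  exists (n : nat) (e : 'I_n -> C2 -> C),
    (forall i, V (e i)) /\
    forall f, V f ->
      exists c : 'I_n -> C, meq f (fun z => \sum_(i < n) c i * e i z).

(** Theta function and twisted elliptic Shibukawa-Ueno operators *)

Definition lattice tau : set C :=
  [set z | exists m n : int, z = m%:~R + n%:~R * tau].

Definition cexp (z : C) : C :=
  Complex (expR (complex.Re z) * cos (complex.Im z)) (expR (complex.Re z) * sin (complex.Im z)).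

Definition ipi : C := Complex 0 (pi : R).

Definition theta_term tau (z : C) (m : int) : C :=
  cexp (ipi * (m%:~R + 2^-1) ^+ 2 * tau
        + 2 * ipi * (m%:~R + 2^-1) * (z + 2^-1)).

(* The sum over all integers m is split as m = k and m = - (k + 1), k >= 0. *)
Definition theta tau (z : C) : C :=
  - (limn (series (fun k : nat => theta_term tau z k%:Z))
     + limn (series (fun k : nat => theta_term tau z (- k.+1%:Z)))).

Definition G tau (z lambda : C) : C :=
  derive1 (theta tau) 0 * theta tau (z + lambda)
    / (theta tau z * theta tau lambda).

(* Acts on representatives; where theta vanishes the pointwise formula takes a
   junk value (division by 0), which is immaterial up to [meq]. *)
Definition SUop tau kappa alpha beta lambda f : C2 -> C := fun z =>
  G tau (z.1 - z.2 - 2 * (alpha * lambda + beta)) lambda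
    * f (z.2 + 2 * alpha * lambda, z.1 - 2 * alpha * lambda)
  - G tau (z.1 - z.2 - 2 * (alpha * lambda + beta)) kappa
    * f (z.1 - 2 * beta, z.2 + 2 * beta).

End Defs.

(* Main.v *)
Require Import Defs.
From mathcomp Require Import all_boot all_order all_algebra.
From mathcomp Require Import complex ring lra zify.
From mathcomp Require Import all_classical all_reals all_analysis.
Import Order.TTheory GRing.Theory Num.Theory numFieldNormedType.Exports.
Local Open Scope classical_set_scope.
Local Open Scope ring_scope.

(** Let [w = z1 - z2 - 2 beta].  If [V] is invariant and spanned by [n] functions
[e_i], and [f] in [V] is nonzero, then for every [lambda]
  [G(w, lambda) f(z2, z1) = sum_i c_i(lambda) e_i(z) + G(w, kappa) f(z1 - 2 beta, z2 + 2 beta)],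
so the kernel [(z, lambda) |-> G(w, lambda)] has rank at most [n + 1] wherever
[f(z2, z1) != 0].  Hence any [n + 2] points [w_j] carry a nontrivial relation
[sum_j a_j G(w_j, lambda) = 0] for all [lambda] in a given finite set.  But
[G(w, lambda + k tau) = exp(-2 pi i k w) G(w, lambda)], so a Vandermonde
determinant kills every [a_j] as soon as the [exp(-2 pi i w_j)] are distinct.
Only the dependence on [lambda] is used globally, so no identity theorem is
needed; using finitely many [lambda] leaves a dense open set of admissible [z].

That [G] is not identically zero needs [theta'(0) != 0] and the nonvanishing of
theta off the lattice.  Both come from the Jacobi triple product, obtained as
the limit of its finite form (the q-binomial theorem) by dominated convergence. *)

(** * Complex modulus and convergence *)

Section ComplexModulus.
Context {R : realType}.
Local Notation C := (cplx R).
Implicit Types z w : C.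

(** A modulus with values in [R]: the norm of [C] lands in [C] itself, whose order is only
    partial. *)
Definition nrm z : R := ComplexField.Normc.normc z.

Lemma cplx_normE z : `|z| = Complex (nrm z) 0. Proof. by []. Qed.

Lemma nrmM z w : nrm (z * w) = nrm z * nrm w.
Proof. exact: (@ComplexField.Normc.normcM R). Qed.

Lemma nrmD z w : nrm (z + w) <= nrm z + nrm w.
Proof. exact: (@le_normcD R). Qed.

Lemma nrmN z : nrm (- z) = nrm z.
Proof. exact: (@normcN R). Qed.

Lemma nrm0 : nrm 0 = 0.
Proof. exact: (@ComplexField.Normc.normc0 R). Qed.

Lemma nrm1 : nrm 1 = 1.
Proof. exact: (@ComplexField.Normc.normc1 R). Qed.

Lemma nrm_ge0 z : 0 <= nrm z.
Proof. by case: z => a b; apply: sqrtr_ge0. Qed.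

Lemma nrm_eq0 z : (nrm z == 0) = (z == 0).
Proof.
apply/eqP/eqP => [|->]; last exact: nrm0.
exact: (@ComplexField.Normc.eq0_normc R).
Qed.

Lemma nrmV z : nrm z^-1 = (nrm z)^-1.
Proof. exact: (@ComplexField.Normc.normcV R). Qed.

Lemma nrmX z n : nrm (z ^+ n) = nrm z ^+ n.
Proof. by elim: n => [|n IH]; rewrite ?expr0 ?nrm1 // !exprS nrmM IH. Qed.

Lemma nrmB z w : nrm (z - w) <= nrm z + nrm w.
Proof. by rewrite -[nrm w]nrmN nrmD. Qed.

Lemma nrm_sum (I : Type) (s : seq I) (P : pred I) (F : I -> C) :
  nrm (\sum_(i <- s | P i) F i) <= \sum_(i <- s | P i) nrm (F i).
Proof.
elim/big_ind2: _ => //; first by rewrite nrm0.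
by move=> a x b y ax bxy; apply: le_trans (nrmD _ _) _; apply: lerD.
Qed.

Lemma Re_nrm z : `|complex.Re z| <= nrm z.
Proof.
by case: z => a b /=; rewrite -sqrtr_sqr ler_sqrt ?addr_ge0 ?sqr_ge0 // lerDl sqr_ge0.
Qed.

Lemma Im_nrm z : `|complex.Im z| <= nrm z.
Proof.
by case: z => a b /=; rewrite -sqrtr_sqr ler_sqrt ?addr_ge0 ?sqr_ge0 // lerDr sqr_ge0.
Qed.

Lemma nrm_ReIm z : nrm z <= `|complex.Re z| + `|complex.Im z|.
Proof.
case: z => a b /=.
rewrite -[leRHS]ger0_norm ?addr_ge0 // -sqrtr_sqr ler_sqrt ?sqr_ge0 //.
rewrite -(real_normK (num_real a)) -(real_normK (num_real b)).
by rewrite sqrrD lerD2r lerDl mulrn_wge0 // mulr_ge0.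
Qed.

Lemma RecD z w : complex.Re (z + w) = complex.Re z + complex.Re w.
Proof. by case: z w => a b [c d]. Qed.
Lemma ImcD z w : complex.Im (z + w) = complex.Im z + complex.Im w.
Proof. by case: z w => a b [c d]. Qed.
Lemma RecB z w : complex.Re (z - w) = complex.Re z - complex.Re w.
Proof. by case: z w => a b [c d]. Qed.
Lemma ImcB z w : complex.Im (z - w) = complex.Im z - complex.Im w.
Proof. by case: z w => a b [c d]. Qed.
Lemma RecM z w : complex.Re (z * w)
  = complex.Re z * complex.Re w - complex.Im z * complex.Im w.
Proof. by case: z w => a b [c d]. Qed.
Lemma ImcM z w : complex.Im (z * w)
  = complex.Re z * complex.Im w + complex.Im z * complex.Re w.
Proof. by case: z w => a b [c d]. Qed.
Lemma Re_nat n : complex.Re (n%:R : C) = n%:R.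
Proof. by elim: n => // n IH; rewrite -natr1 RecD IH -natr1. Qed.
Lemma Im_nat n : complex.Im (n%:R : C) = 0.
Proof. by elim: n => // n IH; rewrite -natr1 ImcD IH addr0. Qed.
Lemma Re_int (m : int) : complex.Re (m%:~R : C) = m%:~R.
Proof.
case: m => n; first exact: Re_nat.
by rewrite NegzE !mulrNz -!pmulrn -(Re_nat n.+1); case: (_%:R : C).
Qed.
Lemma Im_int (m : int) : complex.Im (m%:~R : C) = 0.
Proof.
case: m => n; first exact: Im_nat.
by rewrite NegzE mulrNz -pmulrn -[RHS]oppr0 -(Im_nat n.+1); case: (_%:R : C).
Qed.
Lemma complexP z w : complex.Re z = complex.Re w -> complex.Im z = complex.Im w -> z = w.
Proof. by case: z w => a b [c d] /= -> ->. Qed.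

Lemma gt0_cplx (e : C) : 0 < e -> exists2 r : R, 0 < r & e = Complex r 0.
Proof.
case: e => a b; rewrite ltcE /= => /andP[/eqP -> a0]; by exists a.
Qed.

(** The positive elements of [C] are exactly the positive reals, so testing with real radii
    suffices. *)
Lemma cvgCP {T : Type} {F : set_system T} {FF : Filter F} (u : T -> C) (l : C) :
  u @ F --> l <-> forall e : R, 0 < e -> \forall n \near F, nrm (l - u n) < e.
Proof.
split=> [/cvgrPdist_lt H e e0|H].
  have /H : (0 : C) < Complex e 0 by rewrite ltcE /= eqxx.
  by apply: filterS => n; rewrite cplx_normE ltcE /= => /andP[].
apply/cvgrPdist_lt => e /gt0_cplx[r r0 ->].
by have := H r r0; apply: filterS => n; rewrite cplx_normE ltcE /= eqxx.
Qed.

Lemma cvgC_ReIm (u : nat -> C) (a b : R) :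
  (fun n => complex.Re (u n)) @ \oo --> a -> (fun n => complex.Im (u n)) @ \oo --> b ->
  u @ \oo --> (Complex a b : C).
Proof.
move=> /cvgrPdist_lt ua /cvgrPdist_lt ub; apply/cvgCP => e e0.
have e2 : 0 < e / 2 by rewrite divr_gt0.
near=> n; apply: (le_lt_trans (nrm_ReIm _)).
rewrite RecB ImcB /= [ltRHS]splitr ltrD //; near: n; [exact: ua|exact: ub].
Unshelve. all: by end_near.
Qed.

Lemma is_cvgC_ex (u : nat -> C) : cvgn u -> exists l : C, u @ \oo --> l.
Proof. by move=> /cvg_ex. Qed.

Lemma cvgCM {T : Type} {F : set_system T} {FF : Filter F} (u v : T -> C) (l m : C) :
  u @ F --> l -> v @ F --> m -> (fun x => u x * v x) @ F --> l * m.
Proof. exact: cvgM. Qed.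

Lemma cvgC_unique (u : nat -> C) (l m : C) : u @ \oo --> l -> u @ \oo --> m -> l = m.
Proof. by apply: cvg_unique; exact: norm_hausdorff. Qed.

Lemma cvgCD {T : Type} {F : set_system T} {FF : Filter F} (u v : T -> C) (l m : C) :
  u @ F --> l -> v @ F --> m -> (fun x => u x + v x) @ F --> l + m.
Proof. exact: cvgD. Qed.

(** One domination condition that serves both the series of [u] and the infinite product of
    [1 + u n]. *)
Definition geo_bounded (u : nat -> C) :=
  exists c r : R, [/\ 0 <= c, 0 <= r, r < 1 & forall n, nrm (u n) <= c * r ^+ n].

Lemma geo_bounded_cvg (u : nat -> C) : geo_bounded u -> cvgn (series u).
Proof.
move=> [c [r [c0 r0 r1 ub]]].
have cg : cvgn (series (geometric c r)).
  by apply: is_cvg_geometric_series; rewrite ger0_norm.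
have key (v : nat -> R) : (forall n, `|v n| <= c * r ^+ n) -> cvgn (series v).
  move=> vb; apply: normed_cvg; apply: series_le_cvg cg.
  - by move=> n; rewrite normr_ge0.
  - by move=> n; rewrite mulr_ge0 // exprn_ge0.
  - exact: vb.
have cre : cvgn (series (fun n => complex.Re (u n))).
  by apply: key => n; exact: (le_trans (Re_nrm _)).
have cim : cvgn (series (fun n => complex.Im (u n))).
  by apply: key => n; exact: (le_trans (Im_nrm _)).
apply/cvg_ex; eexists; apply: cvgC_ReIm.
- suff -> : (fun n => complex.Re (series u n)) = series (fun n => complex.Re (u n)) by exact: cre.
  by apply/funext => n; rewrite /series /= (big_morph _ RecD (erefl : complex.Re (0 : C) = 0)).
- suff -> : (fun n => complex.Im (series u n)) = series (fun n => complex.Im (u n)) by exact: cim.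
  by apply/funext => n; rewrite /series /= (big_morph _ ImcD (erefl : complex.Im (0 : C) = 0)).
Qed.

End ComplexModulus.

(** * Geometric domination, infinite products and Tannery's theorem *)

Section ComplexSeries.
Context {R : realType}.
Local Notation C := (cplx R).
Implicit Types (u v t : nat -> C) (c d r M : R).

Lemma bounded_near u M n0 : (forall n, (n0 <= n)%N -> nrm (u n) <= M) ->
  exists2 M', 0 <= M' & forall n, nrm (u n) <= M'.
Proof.
move=> H; have s0 : 0 <= \sum_(k < n0) nrm (u k) by apply: sumr_ge0 => k _; apply: nrm_ge0.
exists (`|M| + \sum_(k < n0) nrm (u k)) => [|n]; first by rewrite addr_ge0.
have [/H un|nn0] := leqP n0 n.
  by apply: (le_trans un); apply: (le_trans (ler_norm _)); rewrite lerDl.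
rewrite (bigD1 (Ordinal nn0)) //= addrCA lerDl addr_ge0 //.
by apply: sumr_ge0 => k _; apply: nrm_ge0.
Qed.

Lemma cvgC_nrm_bounded u (l : C) : u @ \oo --> l -> exists2 M, 0 <= M & forall n, nrm (u n) <= M.
Proof.
move=> /cvgCP/(_ 1 ltr01)[n0 _ H]; apply: (@bounded_near u (nrm l + 1) n0) => n n0n.
have -> : u n = l - (l - u n) by ring.
by apply: (le_trans (nrmB _ _)); rewrite lerD2l; apply/ltW/H.
Qed.

(** Dividing by [r ^+ n], which is where [0 < r] enters, leaves an eventually bounded sequence. *)
Lemma geo_bounded_near u c r n0 : 0 < r -> r < 1 ->
  (forall n, (n0 <= n)%N -> nrm (u n) <= c * r ^+ n) -> geo_bounded u.
Proof.
move=> r0 r1 H.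
have Xr n : nrm ((Complex r 0 : C) ^+ n) = r ^+ n.
  by rewrite nrmX /nrm /= expr0n addr0 sqrtr_sqr gtr0_norm.
have [|M M0 uM] := @bounded_near (fun n => u n / (Complex r 0 : C) ^+ n) c n0.
  by move=> n /H un; rewrite nrmM nrmV Xr ler_pdivrMr // exprn_gt0.
exists M, r; split=> //; first exact: ltW.
by move=> n; have := uM n; rewrite nrmM nrmV Xr ler_pdivrMr // exprn_gt0.
Qed.

Lemma geo_bounded_ratio u n0 :
  (forall n, (n0 <= n)%N -> nrm (u n.+1) <= nrm (u n) / 2) -> geo_bounded u.
Proof.
move=> H; apply: (@geo_bounded_near u (nrm (u n0) * 2 ^+ n0) 2^-1 n0); [lra|lra|].
move=> n; elim: n => [|n IH].
  by rewrite leqn0 => /eqP ->; rewrite expr0 !mulr1.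
rewrite leq_eqVlt => /orP[/eqP ->|].
  by rewrite exprVn mulfK // expf_neq0.
rewrite ltnS => n0n; apply: (le_trans (H _ n0n)).
by rewrite exprSr mulrA ler_pM2r // IH.
Qed.

Lemma geo_boundedM v u M : (forall n, nrm (v n) <= M) -> geo_bounded u ->
  geo_bounded (fun n => v n * u n).
Proof.
move=> vM [c [r [c0 r0 r1 ub]]]; exists (M * c), r.
have M0 : 0 <= M := le_trans (nrm_ge0 _) (vM 0).
split=> [||//|n]; rewrite ?mulr_ge0 //.
by rewrite nrmM -mulrA ler_pM // nrm_ge0.
Qed.

Lemma geo_bounded_cvg0 u : geo_bounded u -> u @ \oo --> 0.
Proof. by move=> /geo_bounded_cvg/cvg_series_cvg_0. Qed.

Lemma sum_geo_le r N : 0 <= r -> r < 1 -> \sum_(n < N) r ^+ n <= (1 - r)^-1.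
Proof.
move=> r0 r1; have r1' : 0 < 1 - r by rewrite subr_gt0.
rewrite -[leRHS]mul1r ler_pdivlMr // mulrC -opprB mulNr.
rewrite -subrX1 opprB gerBl; exact: exprn_ge0.
Qed.

Lemma prod_geo_le c r N : 0 <= c -> 0 <= r -> r < 1 ->
  \prod_(n < N) (1 + c * r ^+ n) <= expR (c / (1 - r)).
Proof.
move=> c0 r0 r1; apply: (@le_trans _ _ (expR (\sum_(n < N) c * r ^+ n))).
  rewrite expR_sum; apply: ler_prod => n _.
  by rewrite expR_ge1Dx addr_ge0 // mulr_ge0 // exprn_ge0.
by rewrite ler_expR -mulr_sumr ler_wpM2l // sum_geo_le.
Qed.

Lemma nrm_prod1D_le u c r N : 0 <= c -> 0 <= r -> (forall n, nrm (u n) <= c * r ^+ n) ->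
  nrm (\prod_(n < N) (1 + u n)) <= \prod_(n < N) (1 + c * r ^+ n).
Proof.
move=> c0 r0 H; elim: N => [|N IH]; first by rewrite !big_ord0 nrm1.
rewrite !big_ord_recr /= nrmM ler_pM ?nrm_ge0 //.
by apply: (le_trans (nrmD _ _)); rewrite nrm1 lerD2l.
Qed.

(** The bound does not depend on [N], so it survives the passage to infinite products and yields
    their continuity in a parameter. *)
Lemma prod1D_dist u v c d r N : 0 <= c -> 0 <= r -> r < 1 ->
  (forall n, nrm (u n) <= c * r ^+ n) -> (forall n, nrm (v n) <= c * r ^+ n) ->
  (forall n, nrm (u n - v n) <= d * r ^+ n) ->
  nrm (\prod_(n < N) (1 + u n) - \prod_(n < N) (1 + v n))
    <= d * ((1 - r)^-1 * expR (c / (1 - r))).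
Proof.
move=> c0 r0 r1 uc vc uv.
have d0 : 0 <= d by have := le_trans (nrm_ge0 _) (uv 0); rewrite expr0 mulr1.
have Xr n : 0 <= r ^+ n by rewrite exprn_ge0.
have S0 n : 0 <= \sum_(k < n) r ^+ k by apply: sumr_ge0.
have E0 n : 0 <= \prod_(k < n) (1 + c * r ^+ k).
  by apply: prodr_ge0 => k _; rewrite addr_ge0 // mulr_ge0.
(* The induction runs with the partial sum and partial product, whose growth absorbs each new
   factor; the constant bound would leave no room. *)
apply: (@le_trans _ _ (d * ((\sum_(n < N) r ^+ n) * \prod_(n < N) (1 + c * r ^+ n)))); last first.
  by rewrite ler_wpM2l // ler_pM ?sum_geo_le ?prod_geo_le.
elim: N => [|N IH]; first by rewrite !big_ord0 subrr nrm0 mul0r mulr0.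
rewrite !big_ord_recr /=.
set P := \prod_(_ < _) _; set Q := \prod_(_ < _) _; set S := \sum_(_ < _) _; set E := \prod_(_ < _) _.
have -> : P * (1 + u N) - Q * (1 + v N) = (P - Q) * (1 + u N) + Q * (u N - v N) by ring.
apply: (le_trans (nrmD _ _)); rewrite !nrmM.
have QE : nrm Q <= E by apply: nrm_prod1D_le.
have uN : nrm (1 + u N) <= 1 + c * r ^+ N by apply: (le_trans (nrmD _ _)); rewrite nrm1 lerD2l.
apply: (@le_trans _ _ (d * (S * E) * (1 + c * r ^+ N) + E * (d * r ^+ N))).
  by apply: lerD; apply: ler_pM; rewrite ?nrm_ge0.
rewrite -subr_ge0.
have -> : d * ((S + r ^+ N) * (E * (1 + c * r ^+ N))) -
   (d * (S * E) * (1 + c * r ^+ N) + E * (d * r ^+ N)) = d * r ^+ N * E * (c * r ^+ N) by ring.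
by rewrite !mulr_ge0 // ?Xr //; apply: E0.
Qed.

(** Consecutive partial products [P n] differ by [P n * u n], so the product is 1 plus a series;
    since the [P n] are bounded, that series is again geometrically dominated. *)
Lemma is_cvg_prod1D u : geo_bounded u -> cvgn (fun N => \prod_(n < N) (1 + u n)).
Proof.
move=> gu; have [c [r [c0 r0 r1 ub]]] := gu.
have cs : cvgn (series (fun n => (\prod_(k < n) (1 + u k)) * u n)).
  apply/geo_bounded_cvg/(@geo_boundedM _ _ (expR (c / (1 - r)))) => // n.
  by apply: le_trans (prod_geo_le _ _ _ c0 r0 r1); apply: nrm_prod1D_le.
apply/cvg_ex; exists (1 + limn (series (fun n => (\prod_(k < n) (1 + u k)) * u n))).
suff -> : (fun N => \prod_(n < N) (1 + u n)) =
    (fun N => 1 + series (fun n => (\prod_(k < n) (1 + u k)) * u n) N).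
  exact: (cvgD (cvg_cst (1 : C)) cs).
apply/funext; elim => [|N IH]; first by rewrite big_ord0 /series /= big_geq // addr0.
by rewrite big_ord_recr /= IH /series /= big_nat_recr //= addrA mulrDr mulr1 -IH.
Qed.

(* The inverse product has factors [1 - u n / (1 + u n)], which are again
   geometrically close to 1, so it converges as well. *)
Lemma cvg_prod1D_neq0 u : geo_bounded u -> (forall n, 1 + u n != 0) ->
  exists2 l : C, l != 0 & (fun N => \prod_(n < N) (1 + u n)) @ \oo --> l.
Proof.
move=> gu u0; pose v n := - (1 + u n)^-1 * u n.
have cu : (fun n => - (1 + u n)^-1) @ \oo --> (- (1 + 0)^-1 : C).
  apply: cvgN; apply: cvgV; first by rewrite addr0 oner_eq0.
  by apply: cvgD; [exact: cvg_cst | exact: geo_bounded_cvg0].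
have [M _ vM] := cvgC_nrm_bounded _ _ cu.
have gv : geo_bounded v by apply: geo_boundedM gu.
have /is_cvgC_ex[l Hl] := is_cvg_prod1D _ gu.
have /is_cvgC_ex[m Hm] := is_cvg_prod1D _ gv.
exists l; last exact: Hl.
have H1 := @cvgCM R nat \oo eventually_filter _ _ _ _ Hl Hm.
suff E : (fun N => (\prod_(n < N) (1 + u n)) * \prod_(n < N) (1 + v n)) = fun=> 1 : C.
  rewrite E in H1; have lm : l * m = 1 by apply: (cvgC_unique _ _ _ H1); apply: cvg_cst.
  by apply/eqP => l0; move: lm => /eqP; rewrite l0 mul0r eq_sym oner_eq0.
apply/funext => N; rewrite -big_split big1 // => n _; rewrite /v.
rewrite /=; have := u0 n; set x := u n => x0; field; exact: x0.
Qed.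

(** Dominated convergence for sums, in the case where all coefficients share the limit [g]. The
    bound is asked only for [k <= N] because only those coefficients are summed. *)
Lemma tannery (c : nat -> nat -> C) (g : C) M t :
  (forall N k, (k <= N)%N -> nrm (c N k) <= M) ->
  (forall k, (fun N => c N k) @ \oo --> g) -> geo_bounded t ->
  (fun N => \sum_(k < N.+1) c N k * t k) @ \oo --> g * limn (series t).
Proof.
move=> cM cg gt; have [d [r [d0 r0 r1 tb]]] := gt.
have M0 : 0 <= M := le_trans (nrm_ge0 _) (cM _ _ (leqnn 0)).
pose M' := M + nrm g.
have M'0 : 0 <= M' by rewrite addr_ge0 ?nrm_ge0.
suff H0 : (fun N => \sum_(k < N.+1) (c N k - g) * t k) @ \oo --> (0 : C).
  have -> : (fun N => \sum_(k < N.+1) c N k * t k) =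
     (fun N => \sum_(k < N.+1) (c N k - g) * t k + g * series t N.+1).
    apply/funext => N; rewrite /series /= big_mkord mulr_sumr -big_split /=.
    by apply: eq_bigr => k _; rewrite -mulrDl subrK.
  rewrite -[g * _]add0r; apply: cvgCD; first exact: H0.
  apply: cvgCM; first exact: cvg_cst.
  by rewrite (cvg_shiftS (series t)); apply: geo_bounded_cvg.
apply/cvgCP => e e0.
(* [K * r ^+ n0] bounds the part of the sum from index [n0] on; the head then has a fixed number of
   terms, each tending to 0. *)
pose K := M' * d / (1 - r).
have K0 : 0 <= K by rewrite !mulr_ge0 // invr_ge0 subr_ge0 ltW.
have [n0 Hn0] : exists n0, K * r ^+ n0 < e / 2.
  have /cvgrPdist_lt/(_ (e / 2)) : (fun n => K * r ^+ n) @ \oo --> K * 0.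
    by apply: cvgM; [exact: cvg_cst | apply: cvg_expr; rewrite ger0_norm].
  rewrite divr_gt0 // => /(_ isT)[n0 _ /(_ n0 (leqnn _))] /=.
  rewrite mulr0 sub0r normrN ger0_norm; first by exists n0.
  by rewrite mulr_ge0 // exprn_ge0.
have fin0 : (fun N => \sum_(k < n0) (c N k - g) * t k) @ \oo --> (0 : C).
  elim: (n0) => [|n IH]; first by under eq_fun do rewrite big_ord0; apply: cvg_cst.
  under eq_fun do rewrite big_ord_recr /=.
  suff H : (fun N => \sum_(k < n) (c N k - g) * t k + (c N n - g) * t n) @ \oo --> 0 + 0 * t n.
    by rewrite mul0r addr0 in H.
  apply: cvgCD; first exact: IH.
  apply: cvgCM; last exact: cvg_cst.
  by rewrite -(subrr g); apply: cvgCD; [exact: cg | exact: cvg_cst].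
near=> N; rewrite sub0r nrmN.
have n0N : (n0 <= N.+1)%N by near: N; exists n0 => //= n /leqW.
rewrite -(big_mkord xpredT (fun k => (c N k - g) * t k)) (big_cat_nat (leq0n n0) n0N) /= big_mkord.
apply: (le_lt_trans (nrmD _ _)); rewrite [ltRHS]splitr; apply: ltr_leD.
  rewrite -nrmN -sub0r; near: N.
  by move/cvgCP: fin0; apply; rewrite divr_gt0.
apply: (le_trans _ (ltW Hn0)).
apply: (le_trans (nrm_sum _ _ _ _)).
apply: (@le_trans _ _ (\sum_(n0 <= k < N.+1) M' * d * r ^+ k)).
  rewrite big_nat [leRHS]big_nat; apply: ler_sum => k /andP[_ kN].
  rewrite nrmM -mulrA ler_pM ?nrm_ge0 //.
  by apply: (le_trans (nrmB _ _)); rewrite lerD2r; apply: cM.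
rewrite -mulr_sumr -[n0 in X in X <= _]add0n big_addn big_mkord.
under eq_bigr do rewrite exprD.
rewrite -mulr_suml /K mulrA ler_wpM2r ?exprn_ge0 // ler_wpM2l ?mulr_ge0 //.
exact: sum_geo_le.
Unshelve. all: by end_near.
Qed.

End ComplexSeries.

(** * The Jacobi triple product *)

Section Gauss.
Context {F : fieldType} (p : F).

Definition qfact n := \prod_(j < n) (1 - p ^+ j.+1).

(** Gaussian binomial coefficients, given by the q-Pascal rule so that no division by [1 - p ^+ j]
    occurs. *)
Fixpoint qbinom n k : F :=
  match n, k with
  | _, 0 => 1
  | 0, _.+1 => 0
  | n'.+1, k'.+1 => qbinom n' k' + p ^+ k'.+1 * qbinom n' k'.+1
  end.

Lemma qbinom0 n : qbinom n 0 = 1. Proof. by case: n. Qed.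

Lemma qbinom_small n k : (n < k)%N -> qbinom n k = 0.
Proof.
elim: n k => [|n IH] [|k] //= nk; rewrite !IH ?mulr0 ?addr0 //.
exact: (ltn_trans (ltnSn n)).
Qed.

(** In the inductive step the two Pascal terms contribute [1 - p ^+ k.+1] and
    [p ^+ k.+1 * (1 - p ^+ (n - k))] times [qfact n]; these factors add up to [1 - p ^+ n.+1]. *)
Lemma qbinom_qfact n k : (k <= n)%N -> qfact k * qfact (n - k) * qbinom n k = qfact n.
Proof.
elim: n k => [|n IH] [|k] //=.
- by rewrite /qfact !big_ord0 !mulr1.
- by rewrite subn0 mulr1 /qfact big_ord0 mul1r.
rewrite ltnS => kn; rewrite subSS mulrDr.
have qS m : qfact m.+1 = qfact m * (1 - p ^+ m.+1) by rewrite /qfact big_ord_recr.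
have [nk|] := ltnP k n; last first.
  move=> nk; have {nk kn} -> : k = n by apply/eqP; rewrite eqn_leq kn.
  rewrite (@qbinom_small n n.+1) // !mulr0 addr0 !qS -[in RHS](IH n (leqnn n)); ring.
have -> : qfact k.+1 * qfact (n - k) * qbinom n k = (1 - p ^+ k.+1) * qfact n.
  by rewrite qS -(IH k kn); ring.
have E : (n - k = (n - k.+1).+1)%N by lia.
have -> : qfact k.+1 * qfact (n - k) * (p ^+ k.+1 * qbinom n k.+1)
    = p ^+ k.+1 * (1 - p ^+ (n - k)) * qfact n.
  by rewrite {1}E (qS (n - k.+1)%N) -(IH k.+1 nk) -E; ring.
rewrite qS; have -> : (n.+1 = k.+1 + (n - k))%N by lia.
by rewrite exprD; ring.
Qed.

(** The q-binomial theorem. Removing the factor [1 + t] leaves the shorter product at [t * p], and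
    the q-Pascal rule recombines the coefficients. *)
Lemma qbinomial (t : F) n : \prod_(j < n) (1 + t * p ^+ j)
  = \sum_(k < n.+1) qbinom n k * p ^+ 'C(k, 2) * t ^+ k.
Proof.
elim: n t => [|n IH] t; first by rewrite big_ord0 big_ord1 /= !mulr1.
rewrite big_ord_recl expr0 mulr1.
under eq_bigr do rewrite exprS mulrA.
rewrite (IH (t * p)) mulrDl mul1r; set T := \sum_(_ < _) _.
have tT : t * T = \sum_(k < n.+1) qbinom n k * p ^+ 'C(k.+1, 2) * t ^+ k.+1.
  rewrite mulr_sumr; apply: eq_bigr => k _.
  by rewrite binS bin1 exprD (exprS t) exprMn; ring.
have TE : T = 1 + \sum_(k < n.+1) p ^+ k.+1 * qbinom n k.+1 * p ^+ 'C(k.+1, 2) * t ^+ k.+1.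
  rewrite /T big_ord_recl qbinom0 !expr0 !mulr1.
  rewrite [in RHS]big_ord_recr /= (@qbinom_small n n.+1) // mulr0 !mul0r addr0.
  by congr (_ + _); apply: eq_bigr => k _; rewrite /bump /= add1n exprMn; ring.
rewrite tT TE [RHS]big_ord_recl qbinom0 !expr0 !mulr1 -addrA -big_split /=.
by congr (_ + _); apply: eq_bigr => k _; rewrite /bump /= add1n; ring.
Qed.

Lemma binomial2_double n : ('C(n, 2) * 2 = n * n.-1)%N.
Proof. by elim: n => [|[|n] IH] //; rewrite binS bin1 mulnDl IH /=; lia. Qed.

(** Bookkeeping for one term of the q-binomial sum: [a] is its index and [b] the power of [y] that
    survives the normalisation. *)
Lemma shifted_term (Q y : F) N k a b : p != 0 -> y != 0 ->
  ('C(N.+1, 2) + 'C(a, 2) = 'C(k.+1, 2) + N * a)%N -> (N = b + a)%N ->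
  y ^+ N * p ^+ 'C(N.+1, 2) * (Q * p ^+ 'C(a, 2) * (y^-1 / p ^+ N) ^+ a)
  = Q * (p ^+ 'C(k.+1, 2) * y ^+ b).
Proof.
move=> p0 y0 E NE.
have E' : p ^+ 'C(N.+1, 2) * p ^+ 'C(a, 2) = p ^+ 'C(k.+1, 2) * p ^+ (N * a).
  by rewrite -!exprD E.
have -> : y ^+ N = y ^+ b * y ^+ a by rewrite -exprD NE.
rewrite exprMn !exprVn -exprM.
have ya : y ^+ a != 0 by rewrite expf_neq0.
have pX : p ^+ (N * a) != 0 by rewrite expf_neq0.
move: E' ya pX; move: (p ^+ _) (p ^+ _) (p ^+ _) (p ^+ _) (y ^+ a) (y ^+ b) => P4 P3 P2 P1 Y1 Y2 E' ya pX.
apply: (@etrans _ _ (P1 * P2 * (Q * Y2) / P4)); first by field; rewrite ya pX.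
by rewrite E'; field.
Qed.

(* The q-binomial theorem for [2 N + 1] factors at [t = 1 / (y p^N)], multiplied
   by [y^N p^(N (N + 1) / 2)]. *)
Lemma finite_triple_product (y : F) N : p != 0 -> y != 0 ->
  (\prod_(n < N) (1 + y * p * p ^+ n)) * \prod_(n < N.+1) (1 + y^-1 * p ^+ n)
  = \sum_(k < N.+1) qbinom (N + N.+1) (N - k) * (p ^+ 'C(k.+1, 2) * y ^+ k)
    + \sum_(k < N.+1) qbinom (N + N.+1) (N.+1 + k) * (p ^+ 'C(k.+1, 2) * y^-1 ^+ k.+1).
Proof.
move=> p0 y0.
have pX n : p ^+ n != 0 by rewrite expf_neq0.
have yX n : y ^+ n != 0 by rewrite expf_neq0.
have := qbinomial (y^-1 / p ^+ N) (N + N.+1).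
rewrite big_split_ord -[(N + N.+1).+1]/(N.+1 + N.+1)%N big_split_ord /=.
(* Reversing the first half of the product and of the sum centres both at the middle. *)
rewrite (reindex_inj rev_ord_inj) [in X in _ = X + _ -> _](reindex_inj rev_ord_inj) /=.
pose c := y ^+ N * p ^+ 'C(N.+1, 2).
(* Each of the first [N] factors receives one [y * p ^+ n.+1], which turns [1 + y^-1 / p ^+ n.+1]
   into [1 + y * p ^+ n.+1]. *)
have cE : c = \prod_(n < N) (y * p ^+ n.+1).
  rewrite big_split /= prodr_const card_ord; congr (_ * _).
  by elim: (N) => [|n IH]; rewrite ?big_ord0 // big_ord_recr /= -IH binS bin1 exprD.
move=> /(congr1 ( *%R c)); rewrite mulrDr !mulr_sumr mulrA {1}cE -big_split /=.
under eq_bigr => n _.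
  have -> : y * p ^+ n.+1 * (1 + y^-1 / p ^+ N * p ^+ (N - n.+1)) = 1 + y * p * p ^+ n.
    have E : p ^+ N = p ^+ (N - n.+1) * p ^+ n.+1 by rewrite -exprD subnK.
    by rewrite E exprS; field; rewrite p0 y0 !pX.
  over.
under [X in _ * X]eq_bigr => n _ do rewrite exprD mulrA divfK //.
move=> ->; congr (_ + _); apply: eq_bigr => k _; rewrite /c.
- rewrite subSS; have kN : (k <= N)%N by rewrite -ltnS.
  apply: shifted_term => //; last by rewrite subnKC.
  have := binomial2_double N.+1; have := binomial2_double (N - k)%N.
  have := binomial2_double k.+1; case: k kN => k /= _ kN; nia.
- have E : ('C(N.+1, 2) + 'C(N.+1 + k, 2) = 'C(k.+1, 2) + N * (N.+1 + k))%N.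
    have := binomial2_double N.+1; have := binomial2_double (N.+1 + k)%N.
    have := binomial2_double k.+1; case: k => k /= _; nia.
  have E' : p ^+ 'C(N.+1, 2) * p ^+ 'C(N.+1 + k, 2) = p ^+ 'C(k.+1, 2) * p ^+ (N * (N.+1 + k)).
    by rewrite -!exprD E.
  rewrite exprMn !exprVn -exprM.
  have -> : y ^+ (N.+1 + k) = y ^+ N * y ^+ k.+1 by rewrite -exprD addSnnS.
  have := pX (N * (N.+1 + k))%N; have := yX N; have := yX k.+1.
  move: E'; move: (p ^+ _) (p ^+ _) (p ^+ _) (p ^+ _) (y ^+ N) (y ^+ k.+1) (qbinom _ _).
  move=> P4 P3 P2 P1 Y1 Y2 Q E' y1 y2 p4.
  apply: (@etrans _ _ (P1 * P2 * (Q / Y2) / P4)); first by field; rewrite y1 y2 p4.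
  by rewrite E'; field; rewrite y1 p4.
Qed.
End Gauss.

(** * Infinite q-Pochhammer symbols and the limit of the finite triple product *)

Section QPochhammer.
Context {R : realType}.
Local Notation C := (cplx R).
Context (p : C) (p1 : nrm p < 1).
Implicit Types a b y : C.

(** In the usual notation, [(-a; p)_oo]. *)
Definition qpoch a : C := limn (fun N => \prod_(n < N) (1 + a * p ^+ n)).

Lemma geo_bounded_qpoch a : geo_bounded (fun n => a * p ^+ n).
Proof.
exists (nrm a), (nrm p); split; rewrite ?nrm_ge0 // => n.
by rewrite nrmM nrmX.
Qed.

Lemma cvg_qpoch a : (fun N => \prod_(n < N) (1 + a * p ^+ n)) @ \oo --> qpoch a.
Proof. exact: (is_cvg_prod1D _ (geo_bounded_qpoch a)). Qed.

Lemma qpoch_neq0 a : (forall n, 1 + a * p ^+ n != 0) -> qpoch a != 0.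
Proof.
move=> H; have [l l0 Hl] := cvg_prod1D_neq0 _ (geo_bounded_qpoch a) H.
by rewrite (cvgC_unique _ _ _ (cvg_qpoch a) Hl).
Qed.

Lemma qpoch_shift a : qpoch a = (1 + a) * qpoch (a * p).
Proof.
have H := cvg_qpoch a; rewrite -(cvg_shiftS _) in H.
apply: (cvgC_unique _ _ _ H).
suff -> : [sequence \prod_(k < n.+1) (1 + a * p ^+ k)]_n =
    (fun n => (1 + a) * \prod_(k < n) (1 + a * p * p ^+ k)).
  by apply: cvgCM; [exact: cvg_cst | exact: cvg_qpoch].
apply/funext => n; rewrite /= big_ord_recl expr0 mulr1; congr (_ * _).
by apply: eq_bigr => k _; rewrite exprS mulrA.
Qed.

(** The finite products are Lipschitz in [a] on a ball, with a constant independent of the number of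
    factors. *)
Lemma qpoch_continuous {T : Type} {F : set_system T} {FF : Filter F} (u : T -> C) a :
  u @ F --> a -> (fun x => qpoch (u x)) @ F --> qpoch a.
Proof.
move=> ua; set c := nrm a + 1.
have c0 : 0 <= c by rewrite addr_ge0 ?nrm_ge0.
have p0 : 0 <= nrm p := nrm_ge0 _.
set L := (1 - nrm p)^-1 * expR (c / (1 - nrm p)).
have L0 : 0 < L by rewrite mulr_gt0 ?expR_gt0 // invr_gt0 subr_gt0.
(* The estimate for finite products passes to the limit at the cost of [e / 2] for each of the two
   truncations. *)
have dist b : nrm b <= c -> nrm (qpoch a - qpoch b) <= nrm (a - b) * L.
  move=> bc; apply/ler_addgt0Pr => e e0.
  have e2 : 0 < e / 2 by rewrite divr_gt0.
  have /cvgCP/(_ _ e2)[n1 _ H1] := cvg_qpoch a.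
  have /cvgCP/(_ _ e2)[n2 _ H2] := cvg_qpoch b.
  have {}H1 := H1 (maxn n1 n2) (leq_maxl _ _).
  have {}H2 := H2 (maxn n1 n2) (leq_maxr _ _).
  move: H1 H2; rewrite /=; set N := maxn _ _.
  set A := \prod_(_ < _) _; set B := \prod_(_ < _) _ => H1 H2.
  have -> : qpoch a - qpoch b = (A - B) + ((qpoch a - A) - (qpoch b - B)) by ring.
  apply: (le_trans (nrmD _ _)); apply: lerD.
    apply: (@prod1D_dist R (fun n => a * p ^+ n) (fun n => b * p ^+ n) c) => // n; rewrite -?mulrBl nrmM nrmX //.
    - by rewrite ler_wpM2r ?exprn_ge0 // lerDl.
    - by rewrite ler_wpM2r ?exprn_ge0.
  by apply: (le_trans (nrmB _ _)); rewrite [leRHS]splitr lerD // ltW.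
apply/cvgCP => e e0.
have eL : 0 < e / L by rewrite divr_gt0.
have near1 : \forall x \near F, nrm (a - u x) < 1 by move/cvgCP: ua; apply.
have near2 : \forall x \near F, nrm (a - u x) < e / L by move/cvgCP: ua; apply.
near=> x.
have h1 : nrm (a - u x) < 1 by near: x.
have h2 : nrm (a - u x) < e / L by near: x.
apply: (le_lt_trans (dist _ _)); last by rewrite -ltr_pdivlMr.
have -> : u x = a - (a - u x) by ring.
by apply: (le_trans (nrmB _ _)); rewrite lerD2l ltW.
Unshelve. all: by end_near.
Qed.

(** The quotient of consecutive terms is [p * y * p ^+ n], which tends to 0. *)
Lemma geo_bounded_theta y : geo_bounded (fun k => p ^+ 'C(k.+1, 2) * y ^+ k).
Proof.
have /cvgCP/(_ 2^-1) := geo_bounded_cvg0 _ (geo_bounded_qpoch (p * y)).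
rewrite invr_gt0 ltr0n => /(_ isT)[n0 _ H].
apply: (@geo_bounded_ratio R _ n0) => n /H /=.
rewrite sub0r nrmN => /ltW h; rewrite binS bin1 exprD exprS [in leLHS]exprS.
have -> : p ^+ 'C(n.+1, 2) * (p * p ^+ n) * (y * y ^+ n)
   = (p ^+ 'C(n.+1, 2) * y ^+ n) * (p * y * p ^+ n) by ring.
by rewrite nrmM ler_wpM2l ?nrm_ge0.
Qed.

Context (p0 : p != 0).

Lemma qfactE n : qfact p n = \prod_(j < n) (1 + - p * p ^+ j).
Proof. by apply: eq_bigr => j _; rewrite exprS mulNr. Qed.

Lemma one_sub_exp_neq0 n : 1 - p ^+ n.+1 != 0.
Proof.
apply/eqP => /eqP; rewrite subr_eq0 => /eqP/(congr1 (@nrm R)).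
rewrite nrm1 nrmX => /esym/eqP; apply/negP; rewrite lt_eqF //.
by rewrite exprn_ilt1 // nrm_ge0.
Qed.

Lemma qfact_neq0 n : qfact p n != 0.
Proof. by apply/prodf_neq0 => j _; apply: one_sub_exp_neq0. Qed.

Lemma cvg_qfact : qfact p n @[n --> \oo] --> qpoch (- p).
Proof. by under eq_fun do rewrite qfactE; apply: cvg_qpoch. Qed.

Lemma qpochNp_neq0 : qpoch (- p) != 0.
Proof.
by apply: qpoch_neq0 => n; rewrite mulNr -exprS one_sub_exp_neq0.
Qed.

(** The coefficients are the central q-binomials as quotients of [qfact]. For fixed [k] all three
    [qfact] tend to [qpoch (- p)], so the coefficient tends to its inverse. *)
Lemma cvg_qbinom_sum t : geo_bounded t ->
  (fun N => \sum_(k < N.+1) qfact p (N + N.+1) / (qfact p (N - k) * qfact p (N.+1 + k)) * t k)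
    @ \oo --> (qpoch (- p))^-1 * limn (series t).
Proof.
move=> gt; have [M M0 HM] := cvgC_nrm_bounded _ _ cvg_qfact.
have cV : (fun n => (qfact p n)^-1) @ \oo --> ((qpoch (- p))^-1 : C).
  by apply: cvgV; [exact: qpochNp_neq0 | exact: cvg_qfact].
have [M' M'0 HM'] := cvgC_nrm_bounded _ _ cV.
refine (@tannery R (fun N k => qfact p (N + N.+1) / (qfact p (N - k) * qfact p (N.+1 + k)))
  _ (M * (M' * M')) t _ _ gt) => [N k _|k].
  by rewrite invfM !nrmM ler_pM ?mulr_ge0 ?nrm_ge0 // ler_pM ?nrm_ge0.
have E : (qpoch (- p))^-1 = qpoch (- p) * ((qpoch (- p))^-1 * (qpoch (- p))^-1).
  by rewrite mulrA divff ?mul1r // qpochNp_neq0.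
rewrite [X in _ --> X]E; under eq_fun do rewrite invfM.
apply: cvgCM.
  apply: (cvg_comp _ _ _ cvg_qfact).
  by apply/cvgnyPge => A; near=> n; rewrite (leq_trans _ (leq_addr _ _)) //; near: n; exists A.
apply: cvgCM; first by rewrite (cvg_centern k (fun n => (qfact p n)^-1)).
apply: (cvg_comp _ _ _ cV).
apply/cvgnyPge => A; near=> n; rewrite (leq_trans _ (leq_addr _ _)) // leqW //; near: n; exists A.
done.
Unshelve. all: by end_near.
Qed.

(** The Jacobi triple product. After division by [qpoch (- p)], both sides are limits of the two
    sides of [finite_triple_product]. *)
Lemma triple_product y : y != 0 ->
  limn (series (fun k => p ^+ 'C(k.+1, 2) * y ^+ k))
    + limn (series (fun k => p ^+ 'C(k.+1, 2) * y^-1 ^+ k.+1))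
  = qpoch (- p) * (qpoch (y * p) * qpoch y^-1).
Proof.
move=> y0.
have g1 := geo_bounded_theta y.
have g2 : geo_bounded (fun k => p ^+ 'C(k.+1, 2) * y^-1 ^+ k.+1).
  have := @geo_boundedM R (fun=> y^-1) _ (nrm y^-1) (fun=> lexx _) (geo_bounded_theta y^-1).
  by congr geo_bounded; apply/funext => k; rewrite exprS; ring.
have lim_l : (fun N => (\prod_(n < N) (1 + y * p * p ^+ n)) * \prod_(n < N.+1) (1 + y^-1 * p ^+ n))
    @ \oo --> qpoch (y * p) * qpoch y^-1.
  apply: cvgCM; first exact: cvg_qpoch.
  by rewrite (cvg_shiftS (fun N => \prod_(n < N) (1 + y^-1 * p ^+ n))); apply: cvg_qpoch.
have := @cvgCD R _ _ eventually_filter _ _ _ _ (cvg_qbinom_sum _ g1) (cvg_qbinom_sum _ g2).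
rewrite -mulrDr => lim_r.
apply: (mulfI (invr_neq0 qpochNp_neq0)); rewrite mulKf ?qpochNp_neq0 //.
apply: (cvgC_unique _ _ _ lim_r).
apply: cvg_trans lim_l; apply: near_eq_cvg; near=> N.
rewrite finite_triple_product //; congr (_ + _); apply: eq_bigr => k _; congr (_ * _).
- have kN : (k <= N)%N by rewrite -ltnS.
  have le : (N - k <= N + N.+1)%N by lia.
  rewrite -(qbinom_qfact p _ _ le); have -> : (N + N.+1 - (N - k) = N.+1 + k)%N by lia.
  by rewrite [RHS]mulrAC divff ?mul1r // mulf_neq0 ?qfact_neq0.
- have kN : (k <= N)%N by rewrite -ltnS.
  have le : (N.+1 + k <= N + N.+1)%N by lia.
  rewrite -(qbinom_qfact p _ _ le); have -> : (N + N.+1 - (N.+1 + k) = N - k)%N by lia.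
  by rewrite [qfact p (N.+1 + k) * _]mulrC [RHS]mulrAC divff ?mul1r // mulf_neq0 ?qfact_neq0.
Unshelve. all: by end_near.
Qed.

End QPochhammer.

(** * The theta function *)

Section Cexp.
Context {R : realType}.
Local Notation C := (cplx R).
Implicit Types z w : C.

Lemma cexpD z w : cexp (z + w) = cexp z * cexp w.
Proof.
apply: complexP; rewrite ?RecM ?ImcM /= RecD ImcD expRD ?cosD ?sinD; ring.
Qed.

Lemma cexp0 : cexp (0 : C) = 1.
Proof. by rewrite /cexp /= expR0 cos0 sin0 mulr1 mulr0. Qed.

Lemma cexpNM z : cexp (- z) * cexp z = 1.
Proof. by rewrite -cexpD addNr cexp0. Qed.

Lemma cexp_neq0 z : cexp z != 0.
Proof.
by apply/eqP => z0; move: (cexpNM z) => /eqP; rewrite z0 mulr0 eq_sym oner_eq0.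
Qed.

Lemma cexpN z : cexp (- z) = (cexp z)^-1.
Proof. by apply: (mulIf (cexp_neq0 z)); rewrite cexpNM mulVf ?cexp_neq0. Qed.

Lemma cexpMn n z : cexp (n%:R * z) = cexp z ^+ n.
Proof.
elim: n => [|n IH]; first by rewrite mul0r cexp0 expr0.
by rewrite -natr1 mulrDl mul1r cexpD IH exprSr.
Qed.

Lemma nrm_cexp z : nrm (cexp z) = expR (complex.Re z).
Proof.
rewrite /nrm /cexp /= !exprMn -mulrDr cos2Dsin2 mulr1 sqrtr_sqr ger0_norm // expR_ge0.
Qed.

Lemma cexp_ipi : cexp (ipi R) = -1.
Proof.
by rewrite /cexp /ipi /= expR0 cospi sinpi mulr0 mul1r; apply: complexP => //=; rewrite oppr0.
Qed.

Lemma ipi_neq0 : ipi R != 0.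
Proof. by apply/eqP => -[] /eqP; rewrite (gt_eqF (pi_gt0 R)). Qed.

(** Reduction modulo [pi * 2] brings [b] into one period, where injectivity of the cosine on
    [[0, pi]] decides. *)
Lemma cos_eq1 (b : R) : cos b = 1 -> exists m : int, b = pi * 2 * m%:~R.
Proof.
move=> cb; set m := Num.floor (b / (pi * 2)).
have p2 : 0 < pi * 2 :> R by rewrite mulr_gt0 ?pi_gt0.
have cosint (x : R) (k : int) : cos (x + pi * 2 * k%:~R) = cos x.
  have nat_case y n : cos (y + pi * 2 * n%:R : R) = cos y.
    by rewrite mulr_natr mulr_natr (periodicn (@cosD2pi R)).
  case: k => n; first exact: nat_case.
  by rewrite NegzE mulrNz mulrN -[LHS](nat_case _ n.+1) addrNK.
exists m; apply/eqP; rewrite -subr_eq0; apply/eqP.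
set x := b - _; have cx : cos x = 1.
  by rewrite -cb -(cosint x m) /x subrK.
have x0 : 0 <= x.
  by rewrite subr_ge0 mulrC -ler_pdivlMr // Num.Theory.ge_floor.
have x2 : x < pi * 2.
  rewrite ltrBlDr -{1}[pi * 2]mulr1 -mulrDr mulrC -ltr_pdivrMr // addrC.
  by have := Num.Theory.floorD1_gt (b / (pi * 2)); rewrite intrD.
have [xp|px] := leP x pi.
  by apply: cos_inj; rewrite ?in_itv /= ?lexx ?pi_ge0 ?x0 // cos0.
(* On the second half of the period, the reflected point lies in [[0, pi]] and would have to be 0,
   against [x < pi * 2]. *)
have : cos (pi * 2 - x) = 1.
  by rewrite -cosN opprB -(cosint (x - pi * 2) 1) mulr1z mulr1 subrK.
rewrite -[RHS]cos0 => /cos_inj; rewrite !in_itv /= lexx pi_ge0.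
have h1 : 0 <= pi * 2 - x <= pi by lra.
by move=> /(_ h1 isT) h2; lra.
Qed.

Lemma cexp_eq1 z : cexp z = 1 -> exists m : int, z = 2 * ipi R * m%:~R.
Proof.
move=> z1; have : expR (complex.Re z) = 1 by rewrite -nrm_cexp z1 nrm1.
rewrite -[RHS]expR0 => /expR_inj Rz.
have [|m Hm] := @cos_eq1 (complex.Im z).
  by have := congr1 (@complex.Re R) z1; rewrite /= Rz expR0 mul1r.
exists m; apply: complexP.
  rewrite Rz !RecM ImcM Re_int Im_int (Im_nat 2) /=; ring.
rewrite Hm !ImcM !RecM Re_int Im_int (Re_nat 2) (Im_nat 2) /=; ring.
Qed.

(** Differentiability at 0 as an explicit first-order bound, so that [expR], [cos] and [sin] can be
    combined into an estimate for [cexp]. *)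
Lemma derive_approx (f : R -> R) (l e : R) : is_derive (0 : R) (1 : R) f l -> 0 < e ->
  exists2 d : R, 0 < d & forall x, `|x| < d -> `|f x - f 0 - l * x| <= e * `|x|.
Proof.
move=> /is_derive1_caratheodory[g [Hg cg g0]] e0.
have /cvgrPdist_lt/(_ e e0)/nbhs_ballP[d /= d0 H] := cg.
exists d => // x xd; have := H x; rewrite /ball /= sub0r normrN => /(_ xd).
rewrite g0 Hg subr0 -mulrBl normrM distrC => /ltW h.
by rewrite ler_wpM2r.
Qed.

Lemma cexp_near0 (e : R) : 0 < e ->
  exists2 d : R, 0 < d & forall z, nrm z < d -> nrm (cexp z - 1 - z) <= e * nrm z.
Proof.
(* The errors add up to at most [e' * |a| + 5 * e' * |b|], with [a] and [b] the real and imaginary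
   parts, hence the 6. The cap at 1 ensures [expR a <= 2]. *)
move=> e0; pose e' := Num.min (e / 6) 1.
have e'0 : 0 < e' by rewrite lt_min ltr01 divr_gt0.
have e'1 : e' <= 1 by rewrite ge_min lexx orbT.
have e'e : e' <= e / 6 by rewrite ge_min lexx.
have [d1 d10 H1] := derive_approx _ _ _ (is_derive_expR 0) e'0.
have [d2 d20 H2] := derive_approx _ _ _ (is_derive_cos 0) e'0.
have [d3 d30 H3] := derive_approx _ _ _ (is_derive_sin 0) e'0.
exists (Num.min (e' / 2) (Num.min d1 (Num.min d2 d3))).
  by rewrite !lt_min d10 d20 d30 divr_gt0.
move=> z; rewrite !lt_min => /and4P[z0 z1 z2 z3].
have Rz := Re_nrm z; have Iz := Im_nrm z.
have {}H1 := H1 _ (le_lt_trans Rz z1).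
have {}H2 := H2 _ (le_lt_trans Iz z2).
have {}H3 := H3 _ (le_lt_trans Iz z3).
move: H1 H2 H3; rewrite expR0 cos0 sin0 oppr0 mul0r !(subr0, oppr0, addr0) !mul1r.
move=> H1 H2 H3.
apply: (le_trans (nrm_ReIm _)); rewrite !RecB !ImcB /= !subr0.
move: Rz Iz H1 H2 H3; set a := complex.Re z; set b := complex.Im z => Rz Iz H1 H2 H3.
have E0 := expR_ge0 a.
have Ea : `|expR a - 1| <= e'.
  have -> : expR a - 1 = (expR a - 1 - a) + a by ring.
  apply: (le_trans (ler_normD _ _)).
  by have := nrm_ge0 z; have := normr_ge0 a; nra.
have E2 : expR a <= 2 by have := ler_norm (expR a - 1); lra.
have -> : expR a * cos b - 1 - a = (expR a - 1 - a) + expR a * (cos b - 1) by ring.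
have -> : expR a * sin b - b = expR a * (sin b - b) + (expR a - 1) * b by ring.
have n1 := ler_normD (expR a - 1 - a) (expR a * (cos b - 1)).
have n2 := ler_normD (expR a * (sin b - b)) ((expR a - 1) * b).
move: n1 n2; rewrite !normrM (ger0_norm E0) => n1 n2.
have m1 : expR a * `|cos b - 1| <= 2 * (e' * `|b|) by rewrite ler_pM.
have m2 : expR a * `|sin b - b| <= 2 * (e' * `|b|) by rewrite ler_pM.
have m3 : `|expR a - 1| * `|b| <= e' * `|b| by rewrite ler_wpM2r.
have q1 : e' * `|a| <= e / 6 * nrm z by rewrite ler_pM // ltW.
have q2 : e' * `|b| <= e / 6 * nrm z by rewrite ler_pM // ltW.
lra.
Qed.

Lemma cexp_continuous0 {T : Type} {F : set_system T} {FF : Filter F} (u : T -> C) :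
  u @ F --> (0 : C) -> (fun x => cexp (u x)) @ F --> (1 : C).
Proof.
move=> u0; apply/cvgCP => e e0.
have [d d0 H] := cexp_near0 _ ltr01.
have e2 : 0 < e / 2 by rewrite divr_gt0.
have near1 : \forall x \near F, nrm (0 - u x) < d by move/cvgCP: u0; apply.
have near2 : \forall x \near F, nrm (0 - u x) < e / 2 by move/cvgCP: u0; apply.
near=> x.
have h1 : nrm (u x) < d by rewrite -nrmN -sub0r; near: x.
have h2 : nrm (u x) < e / 2 by rewrite -nrmN -sub0r; near: x.
have -> : 1 - cexp (u x) = - ((cexp (u x) - 1 - u x) + u x) by ring.
rewrite nrmN; apply: (le_lt_trans (nrmD _ _)); rewrite [ltRHS]splitr ler_ltD //.
by rewrite (le_trans (H _ h1)) // mul1r ltW.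
Unshelve. all: by end_near.
Qed.

Lemma cexp_slope0 : (fun h : C => (cexp h - 1) / h) @ 0^' --> (1 : C).
Proof.
apply/cvgCP => e e0; have e2 : 0 < e / 2 by rewrite divr_gt0.
have [d d0 H] := cexp_near0 _ e2.
have dC : (0 : C) < Complex d 0 by rewrite ltcE /= eqxx.
near=> h.
have h0 : h != 0 by near: h; apply: nbhs_dnbhs_neq.
have hd : nrm h < d.
  have : `|h| < Complex d 0 by near: h; apply: dnbhs0_lt.
  by rewrite cplx_normE ltcE /= => /andP[].
have -> : 1 - (cexp h - 1) / h = - ((cexp h - 1 - h) / h) by field.
rewrite nrmN nrmM nrmV ltr_pdivrMr; last by rewrite lt_neqAle nrm_ge0 eq_sym nrm_eq0 h0.
apply: (le_lt_trans (H _ hd)); rewrite ltr_pM2r; first lra.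
by rewrite lt_neqAle nrm_ge0 eq_sym nrm_eq0 h0.
Unshelve. all: by end_near.
Qed.

End Cexp.

(** * Product formula, nonvanishing, quasi-periodicity and derivative at 0 of theta *)

Section Theta.
Context {R : realType}.
Local Notation C := (cplx R).
Context (tau : C) (tau_gt0 : 0 < complex.Im tau).
Implicit Types z w : C.

(* The square of the nome [exp (pi i tau)]. *)
Definition nome2 : C := cexp (2 * ipi R * tau).
(** The term of index 0 of the theta series, a common factor of all its terms. *)
Definition theta_prefactor z : C := cexp (ipi R * 2^-1 ^+ 2 * tau + ipi R * (z + 2^-1)).
Local Notation p := nome2.
Local Notation K := theta_prefactor.
Local Notation e z := (cexp (2 * ipi R * z)).

Lemma nrm_nome2_lt1 : nrm p < 1.
Proof.
rewrite nrm_cexp -expR0 ltr_expR !RecM !ImcM (Re_nat 2) (Im_nat 2) /=.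
have h := mulr_gt0 (pi_gt0 R) tau_gt0; lra.
Qed.

Lemma nome2_neq0 : p != 0. Proof. exact: cexp_neq0. Qed.

Lemma cexp_turnD z w : e (z + w) = e z * e w.
Proof. by rewrite mulrDr cexpD. Qed.

Lemma cexp_turn_half z : e (z + 2^-1) = - e z.
Proof.
rewrite cexp_turnD (_ : 2 * ipi R * 2^-1 = ipi R); last by field.
by rewrite cexp_ipi mulrN1.
Qed.

Lemma binomial2_natr (F : numFieldType) k : ('C(k.+1, 2)%:R : F) = k%:R * (k%:R + 1) / 2.
Proof.
have := binomial2_double k.+1 => /(congr1 (fun n => n%:R : F)).
by rewrite !natrM -natr1 => E; rewrite -[LHS](mulfK (x := 2)) ?pnatr_eq0 // E; congr (_ / _); ring.
Qed.

(* For [m = k] and for [m = - (k + 1)], [(m + 1/2)^2 = k (k + 1) + 1/4]. *)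
Lemma theta_term_pos z (k : nat) :
  theta_term tau z k%:Z = K z * (p ^+ 'C(k.+1, 2) * (- e z) ^+ k).
Proof.
rewrite -cexp_turn_half -!cexpMn -!cexpD /theta_term -pmulrn binomial2_natr.
by congr cexp; field.
Qed.

Lemma theta_term_neg z (k : nat) :
  theta_term tau z (- k.+1%:Z) = K z * (p ^+ 'C(k.+1, 2) * (- e z)^-1 ^+ k.+1).
Proof.
rewrite -cexp_turn_half -cexpN -!cexpMn -!cexpD /theta_term mulrNz -pmulrn binomial2_natr -natr1.
by congr cexp; field.
Qed.

Lemma limn_seriesZ (a : C) (t : nat -> C) : geo_bounded t ->
  limn (series (fun k => a * t k)) = a * limn (series t).
Proof.
move=> /geo_bounded_cvg ct; apply: (cvg_lim (@norm_hausdorff _ _)).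
suff -> : series (fun k => a * t k) = (fun n => a * series t n).
  by apply: cvgCM; [exact: cvg_cst | exact: ct].
by apply/funext => n; rewrite /series /= mulr_sumr.
Qed.

(** The triple product at [y = - e z]; the sign comes from the shift by [1/2] in the series. *)
Lemma theta_product z :
  theta tau z = - (K z * (qpoch p (- p) * (qpoch p (- e z * p) * qpoch p (- e z)^-1))).
Proof.
have y0 : - e z != 0 by rewrite oppr_eq0 cexp_neq0.
rewrite /theta; congr (- _).
rewrite -triple_product ?nrm_nome2_lt1 ?nome2_neq0 // mulrDr.
have g1 := geo_bounded_theta p nrm_nome2_lt1 (- e z).
have g2 : geo_bounded (fun k => p ^+ 'C(k.+1, 2) * (- e z)^-1 ^+ k.+1).
  have := @geo_boundedM R (fun=> (- e z)^-1) _ (nrm (- e z)^-1) (fun=> lexx _)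
    (geo_bounded_theta p nrm_nome2_lt1 (- e z)^-1).
  by congr geo_bounded; apply/funext => k; rewrite exprS; ring.
by rewrite -!limn_seriesZ //; congr (limn (series _) + limn (series _));
  apply/funext => k; rewrite ?theta_term_pos ?theta_term_neg.
Qed.

(** A factor of the product can vanish only if [e (z + n tau) = 1] for some integer [n], which
    forces [z] into the lattice. *)
Lemma theta_neq0 z : ~ lattice tau z -> theta tau z != 0.
Proof.
move=> zL; have Ep (n : int) : e (z + n%:~R * tau) != 1.
  apply/eqP => /cexp_eq1[m Hm].
  apply: zL; exists m, (- n).
  have /mulfI E2 : 2 * ipi R != 0 by rewrite mulf_neq0 ?ipi_neq0 ?pnatr_eq0.
  by rewrite -(E2 _ _ Hm) mulrNz; ring.
have eX n : e (n%:R * tau) = p ^+ n by rewrite -cexpMn; congr cexp; ring.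
rewrite theta_product oppr_eq0 !mulf_neq0 ?cexp_neq0 //.
- exact: (qpochNp_neq0 _ nrm_nome2_lt1).
- apply: (qpoch_neq0 _ nrm_nome2_lt1) => n.
  rewrite -[- e z * p * _]mulrA -exprS -eX mulNr -cexp_turnD.
  by rewrite subr_eq0 eq_sym; apply: (Ep n.+1).
(* The second product accounts for the nonpositive multiples of [tau], the first one for the
   positive multiples. *)
- apply: (qpoch_neq0 _ nrm_nome2_lt1) => n.
  rewrite invrN mulNr subr_eq0 -cexpN -eX -cexpD.
  apply/eqP => E; have := Ep (- n%:Z); rewrite mulrNz -pmulrn.
  have -> : 2 * ipi R * (z + - n%:R * tau) = - (- (2 * ipi R * z) + 2 * ipi R * (n%:R * tau)) by ring.
  by rewrite cexpN -E invr1 eqxx.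
Qed.

(** Adding [tau] multiplies [e z] by [p], which shifts the two infinite products in opposite
    directions; the two leading factors released have a monomial quotient. *)
Lemma theta_quasiperiodic z :
  theta tau (z + tau) = - cexp (- (ipi R * tau)) * e (- z) * theta tau z.
Proof.
have p0 := nome2_neq0; have ez : e z != 0 := cexp_neq0 _.
have EK : K (z + tau) = cexp (ipi R * tau) * K z by rewrite -cexpD; congr cexp; ring.
have Ep : p = cexp (ipi R * tau) * cexp (ipi R * tau) by rewrite -cexpD; congr cexp; ring.
rewrite !theta_product EK cexp_turnD -/p.
rewrite [in RHS](qpoch_shift _ nrm_nome2_lt1 (- e z * p)).
rewrite [in LHS](qpoch_shift _ nrm_nome2_lt1 (- (e z * p))^-1).
have -> : (- (e z * p))^-1 * p = (- e z)^-1 by field; rewrite p0 ez.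
have -> : - (e z * p) * p = - e z * p * p by ring.
have -> : 2 * ipi R * - z = - (2 * ipi R * z) by ring.
rewrite !cexpN; have q0 : cexp (ipi R * tau) != 0 := cexp_neq0 _.
move: (qpoch _ _) (qpoch _ _) (qpoch _ _) (K z) => A B D E.
move: p0 ez q0; rewrite Ep; move: (cexp (ipi R * tau)) (e z) => q x q2 x0 q0.
by field; rewrite q0 x0.
Qed.

Lemma dnbhs0_cvg_mul (a : C) : (fun h : C => a * h) @ 0^' --> (0 : C).
Proof.
suff H : (fun h : C => a * h) @ 0^' --> a * 0 by rewrite mulr0 in H.
apply: cvgCM; first exact: cvg_cst.
by apply: cvg_within_filter; exact: cvg_id.
Qed.

(** [cexp_slope0] is a limit on punctured neighbourhoods, so a rescaled increment must also avoid
    0. *)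
Lemma dnbhs0_mul (a : C) : a != 0 -> (fun h : C => a * h) @ 0^' --> 0^'.
Proof.
move=> a0 A HA.
have H : \forall h \near (0 : C)^', a * h != 0 -> A (a * h) by exact: (dnbhs0_cvg_mul a _ HA).
change (\forall h \near (0 : C)^', A (a * h)).
have N : \forall h \near (0 : C)^', h != 0 by apply: nbhs_dnbhs_neq.
near=> h; have h0 : h != 0 by near: h.
have hH : a * h != 0 -> A (a * h) by near: h.
by apply: hH; rewrite mulf_neq0.
Unshelve. all: by end_near.
Qed.

Lemma theta0 : theta tau 0 = 0.
Proof.
rewrite theta_product (qpoch_shift _ nrm_nome2_lt1 (- e 0)^-1) mulr0 cexp0.
by rewrite invrN invr1 subrr mul0r !mulr0 oppr0.
Qed.

(** Near 0, theta is the vanishing factor [1 - (e h)^-1] times factors that are continuous and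
    nonzero at 0. *)
Lemma derive1_theta_neq0 : derive1 (theta tau) 0 != 0.
Proof.
(* Up to simplification [l] is [- 2 pi i K(0) qpoch(- p)^3]; the written form lists the limit of
   each factor of the difference quotient, the 1s coming from [cexp] and from its slope. *)
set l : C := - (K 0 * 1 * (2 * ipi R * 1) * (qpoch p (- p) * (qpoch p (- 1 * p) * qpoch p (- 1 * p)))).
have l0 : l != 0.
  rewrite oppr_eq0 !mulf_neq0 ?cexp_neq0 ?ipi_neq0 ?pnatr_eq0 ?oner_eq0 //;
    by rewrite ?mulN1r (qpochNp_neq0 _ nrm_nome2_lt1).
suff -> : derive1 (theta tau) 0 = l by [].
have cM := dnbhs0_cvg_mul.
have cM' := dnbhs0_mul.
have i0 : - (2 * ipi R) != 0 by rewrite oppr_eq0 mulf_neq0 ?ipi_neq0 ?pnatr_eq0.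
have cN : (fun=> -1 : C) @ (0 : C)^' --> (-1 : C) by exact: cvg_cst.
have lim : (fun h : C => - (K 0 * cexp (ipi R * h)
    * (2 * ipi R * ((cexp (- (2 * ipi R) * h) - 1) / (- (2 * ipi R) * h)))
    * (qpoch p (- p) * (qpoch p (-1 * cexp (2 * ipi R * h) * p)
       * qpoch p (-1 * cexp (- (2 * ipi R) * h) * p))))) @ 0^' --> l.
  have cE (a : C) : (fun h : C => cexp (a * h)) @ 0^' --> (1 : C).
    by apply: cexp_continuous0; apply: cM.
  have cQ (a : C) : (fun h : C => qpoch p (-1 * cexp (a * h) * p)) @ 0^' --> qpoch p (- 1 * p).
    apply: (qpoch_continuous _ nrm_nome2_lt1); apply: cvgCM; last exact: cvg_cst.
    suff H : (fun h : C => -1 * cexp (a * h)) @ 0^' --> (-1 * 1 : C) by rewrite mulr1 in H.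
    by apply: cvgCM; [exact: cN | exact: cE].
  apply: cvgN; apply: cvgCM; last first.
    by apply: cvgCM; [exact: cvg_cst | apply: cvgCM; apply: cQ].
  apply: cvgCM; first by apply: cvgCM; [exact: cvg_cst | exact: cE].
  apply: cvgCM; first exact: cvg_cst.
  exact: (cvg_comp _ _ (cM' _ i0) cexp_slope0).
rewrite /derive1; apply: (cvg_lim (@norm_hausdorff _ _)).
apply: cvg_trans lim; apply: near_eq_cvg; near=> h.
have h0 : h != 0 by near: h; apply: nbhs_dnbhs_neq.
rewrite theta0 subr0 addr0 theta_product (qpoch_shift _ nrm_nome2_lt1 (- e h)^-1).
have -> : K h = K 0 * cexp (ipi R * h) by rewrite -cexpD; congr cexp; ring.
have -> : cexp (- (2 * ipi R) * h) = (e h)^-1 by rewrite -cexpN; congr cexp; ring.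
rewrite invrN !mulN1r.
have eh : e h != 0 := cexp_neq0 _.
have j0 := ipi_neq0 (R := R).
rewrite /GRing.scale /=.
move: eh j0 (qpoch _ _) (qpoch _ _) (qpoch _ _) (K 0) (cexp (ipi R * h)).
move: (e h) (ipi R) => x j x0 j0 A B D E F.
by field; rewrite h0 x0 j0.
Unshelve. all: by end_near.
Qed.

End Theta.

(** * Invariant subspaces *)

Lemma vandermonde_kernel (F : fieldType) (m : nat) (x b : 'I_m -> F) : injective x ->
  (forall k : 'I_m, \sum_j x j ^+ k * b j = 0) -> forall j, b j = 0.
Proof.
move=> xinj H j.
set V := Vandermonde m (\row_i x i); set B := \col_i b i.
have VB : V *m B = 0.
  apply/matrixP => i k; rewrite !mxE -[RHS](H i).
  by apply: eq_bigr => l _; rewrite !mxE.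
have Vu : V \in unitmx.
  rewrite unitmxE unitfE det_Vandermonde.
  apply/prodf_neq0 => i _; apply/prodf_neq0 => k ik; rewrite !mxE subr_eq0.
  by apply: contraTneq ik => /xinj ->; rewrite ltnn.
have /matrixP/(_ j ord0) : B = 0 by rewrite -(mulKmx Vu B) VB mulmx0.
by rewrite !mxE.
Qed.

Lemma exists_left_kernel (F : fieldType) (m n : nat) (M : 'M[F]_(m, n)) : (n < m)%N ->
  exists2 a : 'rV_m, a != 0 & a *m M = 0.
Proof.
move=> nm; have : kermx M != 0.
  rewrite kermx_eq0 /row_free; apply/eqP => E.
  by have := rank_leq_col M; rewrite E leqNgt nm.
by move=> /rowV0Pn[a /sub_kermxP aM a0]; exists a.
Qed.

(** Turns finitely many identities up to [meq] into pointwise identities on one common dense open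
    set. *)
Lemma dense_open_finI (T : topologicalType) (I : eqType) (s : seq I) (A : I -> set T) :
  (forall i, open (A i)) -> (forall i, dense (A i)) ->
  exists2 D : set T, open D /\ dense D & forall i, i \in s -> D `<=` A i.
Proof.
move=> oA dA; elim: s => [|i s [D [opD dD] DA]].
  exists setT => //; split; first exact: openT.
  by move=> O O0 _; rewrite setIT.
exists (A i `&` D); first by split; [exact: openI | exact: denseI].
move=> j; rewrite inE => /orP[/eqP -> x []//|/DA js x [_ /js]//].
Qed.

(** * Linear independence of the functions [G tau w] for distinct exponentials of [w] *)

Section Main.
Context {R : realType}.
Local Notation C := (cplx R).
Context (tau : C) (tau_gt0 : 0 < complex.Im tau).
Implicit Types z w lambda : C.

Local Notation e z := (cexp (2 * ipi R * z)).

Lemma latticeB z w : lattice tau z -> lattice tau w -> lattice tau (z - w).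
Proof.
move=> [m [n ->]] [m' [n' ->]]; exists (m - m'), (n - n').
by rewrite !intrD !mulrNz; ring.
Qed.

Lemma lattice_shift z k : lattice tau (z + k%:R * tau) -> lattice tau z.
Proof.
move=> zL; have -> : z = z + k%:R * tau - k%:R * tau by rewrite addrK.
by apply: latticeB zL _; exists 0, k%:Z; rewrite add0r -pmulrn.
Qed.

(** The imaginary part removes the multiple of [tau], leaving an integer of absolute value strictly
    between 0 and 1. *)
Lemma not_lattice_real (r : R) : 0 < `|r| < 1 -> ~ lattice tau (Complex r 0).
Proof.
move=> r01 [m [n E]].
have := congr1 (@complex.Im R) E; rewrite ImcD ImcM Im_int Re_int Im_int /= mul0r addr0 add0r.
move=> /esym/eqP; rewrite mulf_eq0 (gt_eqF tau_gt0) orbF intr_eq0 => /eqP n0.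
have := congr1 (@complex.Re R) E; rewrite n0 mul0r addr0 Re_int /= => rm.
move: r01; rewrite rm -intr_norm ltr0z ltrz1; case: m {E rm} => m; lia.
Qed.

(** The multipliers of theta at [w + lambda] and at [lambda] divide to a factor free of [lambda];
    this makes [e (- w)] a Vandermonde node. *)
Lemma G_quasiperiodic w lambda : G tau w (lambda + tau) = e (- w) * G tau w lambda.
Proof.
rewrite /G addrA !theta_quasiperiodic //.
have -> : e (- (w + lambda)) = e (- w) * e (- lambda) by rewrite -cexpD; congr cexp; ring.
rewrite !invfM.
have := cexp_neq0 (- (ipi R * tau)); have := cexp_neq0 (2 * ipi R * - lambda).
move: (cexp _) (cexp _) (theta tau w)^-1 (theta tau lambda)^-1 => x y A B x0 y0.
by field; rewrite x0 y0.
Qed.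

Lemma G_quasiperiodicX w lambda k :
  G tau w (lambda + k%:R * tau) = e (- w) ^+ k * G tau w lambda.
Proof.
elim: k => [|k IH]; first by rewrite mul0r addr0 expr0 mul1r.
by rewrite -natr1 mulrDl mul1r addrA G_quasiperiodic IH exprS mulrA.
Qed.

(* [1/2 - 1/3] is not a lattice point, so [w + 1/2] and [w + 1/3] cannot both be. *)
Definition base_lambda (b : bool) : C := Complex (if b then 2^-1 else 3^-1) 0.

Lemma base_lambda_nlattice b k : ~ lattice tau (base_lambda b + k%:R * tau).
Proof.
move=> /lattice_shift; apply: not_lattice_real.
by case: b; rewrite ger0_norm; lra.
Qed.

Lemma G_base_neq0 w : ~ lattice tau w -> exists b, G tau w (base_lambda b) != 0.
Proof.
move=> wL.
have [b bL] : exists b, ~ lattice tau (w + base_lambda b).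
  have [H|] := pselect (lattice tau (w + base_lambda true)); last by exists true.
  exists false => H'; have := latticeB _ _ H H'.
  have -> : w + base_lambda true - (w + base_lambda false) = Complex (2^-1 - 3^-1) 0.
    by rewrite opprD addrACA subrr add0r; apply: complexP; rewrite ?RecB ?ImcB //= subrr.
  by apply: not_lattice_real; rewrite ger0_norm; lra.
exists b; have := @base_lambda_nlattice b 0; rewrite mul0r addr0 => bL'.
by rewrite /G !mulf_neq0 ?invr_neq0 ?mulf_neq0 ?theta_neq0 ?derive1_theta_neq0.
Qed.

(** For each [b] the relations form a Vandermonde system in the unknowns
    [a j * G tau (w j) (base_lambda b)]. Both values of [b] are required because the one with a
    nonzero [G] depends on [j]. *)
Lemma G_independent m (w a : 'I_m -> C) : (forall j, ~ lattice tau (w j)) ->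
  injective (fun j => e (- w j)) ->
  (forall b (k : 'I_m), \sum_j a j * G tau (w j) (base_lambda b + k%:R * tau) = 0) ->
  forall j, a j = 0.
Proof.
move=> wL winj H j; have [b Gb] := G_base_neq0 _ (wL j).
have : a j * G tau (w j) (base_lambda b) = 0.
  apply: (vandermonde_kernel _ _ _ (fun j => a j * G tau (w j) (base_lambda b)) winj) => k.
  rewrite -[RHS](H b k); apply: eq_bigr => i _.
  by rewrite G_quasiperiodicX mulrCA.
by move=> /eqP; rewrite mulf_eq0 (negbTE Gb) orbF => /eqP.
Qed.

Lemma SUop0 kappa beta lambda (f : C * C -> C) z1 z2 :
  SUop tau kappa 0 beta lambda f (z1, z2)
  = G tau (z1 - z2 - 2 * beta) lambda * f (z2, z1)
    - G tau (z1 - z2 - 2 * beta) kappa * f (z1 - 2 * beta, z2 + 2 * beta).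
Proof. by rewrite /SUop /= mul0r mulr0 mul0r add0r addr0 subr0. Qed.

End Main.

Section Open.
Context {R : realType}.
Local Notation C := (cplx R).

(** A representative may take arbitrary values on a nowhere dense set, so nonvanishing at one point
    must be sought where [f = g / h] holds on an open set; continuity of [g] then spreads it. *)
Lemma meromorphic_nonzero (f : C * C -> C) : meromorphic f -> ~ meq f (fun=> 0) ->
  exists2 W : set (C * C), open W /\ W !=set0 & forall z, W z -> f z != 0.
Proof.
move=> mf /denseNE[Q [[x [opQ Qx]] Q0]].
have [U [g [h [[opU Ux] hg hh Ucl]]]] := mf x.
set D := [set z | _]° in Ucl.
have oD : open D by exact: open_interior.
have [y [Dy [Qy Uy]]] : D `&` (Q `&` U) !=set0.
  by apply: (Ucl x Ux); apply: open_nbhs_nbhs; split; [exact: openI|].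
(* Otherwise [f] would vanish on an open set around [y], putting [y] in the interior of its zero
   set, which [Q] avoids. *)
have [y' [Dy' Qy' Uy'] fy'] : exists2 y', [/\ D y', Q y' & U y'] & f y' != 0.
  apply: contrapT => H.
  suff : (Q `&` [set z | f z = (fun=> 0) z]°) y by rewrite Q0.
  split=> //.
  suff : D `&` (Q `&` U) `<=` [set z | f z = (fun=> 0) z].
    move=> DS; rewrite /interior nbhsE /=; exists (D `&` (Q `&` U)) => //.
    by split; [apply: openI => //; apply: openI | ].
  move=> z [Dz [Qz Uz]] /=; apply/eqP; apply: contrapT => /negP fz.
  by apply: H; exists z.
have gy' : g y' != 0.
  by have [_ E] := interior_subset Dy'; apply: contraNneq fy' => g0; rewrite E g0 mul0r.
exists (interior (D `&` [set z | g z != 0])).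
  split; first exact: open_interior.
  exists y'; change (nbhs y' (D `&` [set z | g z != 0])).
  apply: filterI; first exact: open_nbhs_nbhs.
  have cg : {for y', continuous g} by apply: differentiable_continuous; apply: hg.
  exact: (cvgr_neq0 _ cg gy').
move=> z /interior_subset[/interior_subset[hz ->] gz].
by rewrite mulf_neq0 ?invr_neq0.
Qed.

End Open.

(** * Choice of sample points off the poles with distinct exponentials *)

Section Points.
Context {R : realType}.
Local Notation C := (cplx R).
Context (tau : C) (tau_gt0 : 0 < complex.Im tau).

Lemma open_shift_fst (Q : set (C * C)) z : open Q -> Q z ->
  exists2 d : R, 0 < d & forall t : R, `|t| < d -> Q (z.1 + Complex t 0, z.2).
Proof.
move=> opQ Qz.
have [[A B] /= [Az Bz] AB] : nbhs (z.1, z.2) Q.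
  by apply: open_nbhs_nbhs; split=> //; case: z Qz.
have /nbhs_ballP[e' /gt0_cplx[d d0 ->] H] := Az.
have Bz' : B z.2 by exact: (@nbhs_singleton C z.2 B Bz).
exists d => // t td; apply: (AB (_, _)); split=> //=. 
apply: H; rewrite /ball_ /= opprD addrA subrr sub0r normrN cplx_normE ltcE /= eqxx /=.
by rewrite expr0n addr0 sqrtr_sqr.
Qed.

(** A real segment shorter than 1 contains at most one lattice point; if there is one, [d'] stops
    just before it. *)
Lemma lattice_avoid (w : C) (d : R) : 0 < d -> d <= 2^-1 ->
  exists2 d' : R, 0 < d' <= d & forall t : R, 0 < t < d' -> ~ lattice tau (w + Complex t 0).
Proof.
move=> d0 d2.
have [[t0 /andP[t00 t0d] t0L]|H] := pselect (exists2 t, 0 < t < d & lattice tau (w + Complex t 0)).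
  exists t0; first by rewrite t00 ltW.
  move=> t /andP[tt0 tt] tL; have := latticeB _ _ _ t0L tL.
  have -> : w + Complex t0 0 - (w + Complex t 0) = Complex (t0 - t) 0.
    by rewrite opprD addrACA subrr add0r; apply: complexP; rewrite ?RecB ?ImcB //= subrr.
  by apply: not_lattice_real => //; rewrite ger0_norm; lra.
exists d; first by rewrite d0 /=.
by move=> t td tL; apply: H; exists t.
Qed.

Lemma generic_points (Q : set (C * C)) (beta : C) (m : nat) : open Q -> Q !=set0 ->
  exists z : 'I_m -> C * C,
    [/\ forall j, Q (z j), forall j, ~ lattice tau ((z j).1 - (z j).2 - 2 * beta)
      & injective (fun j => cexp (2 * ipi R * - ((z j).1 - (z j).2 - 2 * beta)))].
Proof.
move=> opQ [z Qz]; have [d d0 H] := open_shift_fst _ _ opQ Qz.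
pose w := z.1 - z.2 - 2 * beta.
have [|| d' /andP[d'0 d'd] Hd'] := lattice_avoid w (Num.min d 2^-1).
- by rewrite lt_min d0 /=; lra.
- by rewrite ge_min lexx orbT.
move: d'd; rewrite le_min => /andP[d'd d'2].
(* The offset 2 keeps every [t j] strictly below [d']. As [d' <= 1/2], two of them never differ by a
   nonzero integer, so the exponentials are distinct. *)
pose t (j : 'I_m) : R := d' / j.+2%:R.
pose tC j : C := Complex (t j) 0.
have t0 j : 0 < t j by rewrite divr_gt0.
have td j : t j < d' by rewrite ltr_pdivrMr // ltr_pMr // ltr1n.
exists (fun j => (z.1 + tC j, z.2)); split => /= [j|j|].
- by apply: H; rewrite ger0_norm ?(ltW (t0 j)) // (lt_le_trans (td j)).
- have -> : z.1 + tC j - z.2 - 2 * beta = w + tC j by rewrite /w; ring.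
  by apply: Hd'; rewrite t0 td.
move=> i j /= E.
have : cexp (2 * ipi R * (tC j - tC i)) = 1.
  have := congr1 (fun x => (cexp (2 * ipi R * - (z.1 + tC j - z.2 - 2 * beta)))^-1 * x) E.
  rewrite mulVf ?cexp_neq0 // -cexpN -cexpD; apply: etrans; congr cexp; ring.
move=> /cexp_eq1[k].
have /mulfI i0 : 2 * ipi R != 0 by rewrite mulf_neq0 ?ipi_neq0 ?pnatr_eq0.
move=> /i0/(congr1 (@complex.Re R)); rewrite RecB Re_int /= => tk.
have kk : `|t j - t i| < 1 by rewrite ltr_norml; have := t0 i; have := t0 j; have := td i; have := td j; lra.
have k0 : k = 0 by move: kk; rewrite tk -intr_norm ltrz1; lia.
move: tk; rewrite k0 => /eqP; rewrite subr_eq0 => /eqP.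
move=> /(mulfI (lt0r_neq0 d'0))/invr_inj/eqP; rewrite eqr_nat => /eqP[] ?.
exact: val_inj.
Qed.

End Points.

(** The operator evaluates [f] at the swapped point, so the open set where [f] is nonzero has to be
    swapped too. *)
Lemma open_swap (T : topologicalType) (W : set (T * T)) :
  open W -> open [set z | W (z.2, z.1)].
Proof.
move=> opW; rewrite openE => -[x y] /= Wyx.
have [[A B] /= [Ay Bx] AB] : nbhs (y, x) W by apply: open_nbhs_nbhs.
by exists (B, A) => // -[u v] [Bu Av]; apply: (AB (v, u)).
Qed.

Theorem theorem4p3 (R : realType) (tau kappa beta : cplx R)
    (Htau : 0 < complex.Im tau) (Hkappa : ~ lattice tau kappa) :
  ~ exists V : set (cplx R * cplx R -> cplx R),
      [/\ mero_subspace V, nonzero_subspace V, finite_dimensional V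
        & forall lambda : cplx R, ~ lattice tau lambda ->
            forall f, V f -> V (SUop tau kappa 0 beta lambda f)].
Proof.
move=> [V [[Vmero _ _ _] [f Vf f0] [n [b [_ bspan]]] Vinv]].
have [W [opW W0] fW] := meromorphic_nonzero _ (Vmero _ Vf) f0.
(* One point more than the [n + 1] columns of [M]: the [n] spanning functions and the [kappa] term.
   The parameters [lam i] are those for which [G_independent] needs relations. *)
pose N := n.+2; pose lam (i : bool * 'I_N) : cplx R := base_lambda i.1 + i.2%:R * tau.
have /choice[c Hc] : forall i, exists c : 'I_n -> cplx R,
    meq (SUop tau kappa 0 beta (lam i) f) (fun z => \sum_(k < n) c k * b k z).
  by move=> i; apply/bspan/Vinv => //; apply: base_lambda_nlattice.
(* Only finitely many parameters [lam i] occur, so all the expansions hold pointwise on a common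
   dense open set. *)
have [D [opD dD] HD] := dense_open_finI _ _ (enum {: bool * 'I_N})
  (fun i => [set z | SUop tau kappa 0 beta (lam i) f z = \sum_(k < n) c i k * b k z]°)
  (fun=> open_interior _) Hc.
pose W' : set (cplx R * cplx R) := [set z | W (z.2, z.1)].
have opW' : open W' by exact: open_swap opW.
have W'0 : W' !=set0 by case: W0 => -[x y] Wxy; exists (y, x).
have [z [zQ zL zinj]] := generic_points _ Htau _ beta N (openI opW' opD) (dD _ W'0 opW').
pose w j := (z j).1 - (z j).2 - 2 * beta.
pose fs j := f ((z j).2, (z j).1).
have fs0 j : fs j != 0 by have [/fW] := zQ j.
(* Entries are divided by [fs j], so that [G tau (w j) (lam i)] becomes a combination of the columns
   with coefficients independent of [j]. The [kappa] term does not involve the parameter and costs a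
   single column. *)
pose M : 'M[cplx R]_(N, n + 1) := row_mx (\matrix_(j < N, k < n) (b k (z j) / fs j))
  (\col_(j < N) (G tau (w j) kappa * f ((z j).1 - 2 * beta, (z j).2 + 2 * beta) / fs j)).
have [|a a0] := exists_left_kernel _ _ _ M; first by rewrite addn1.
rewrite mul_mx_row => /eqP; rewrite row_mx_eq0 => /andP[/eqP aM1 /eqP aM2].
case/negP: a0; apply/eqP/rowP => j; rewrite mxE.
apply: (G_independent _ Htau _ w (fun j => a 0 j) zL zinj) => b' k {j}.
have E j : G tau (w j) (lam (b', k)) = \sum_(l < n) c (b', k) l * (b l (z j) / fs j)
    + G tau (w j) kappa * f ((z j).1 - 2 * beta, (z j).2 + 2 * beta) / fs j.
  have [_ Dz] := zQ j.
  have := interior_subset (HD (b', k) (mem_enum _ _) _ Dz).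
  rewrite /= [z j]surjective_pairing SUop0 /= -/(w j) => H.
  apply: (mulIf (fs0 j)); rewrite mulrDl divfK // mulr_suml.
  under [in RHS]eq_bigr do rewrite -mulrA divfK //.
  have -> : z j = ((z j).1, (z j).2) by case: (z j).
  by rewrite -H subrK.
(* The row vector [a] annihilates every column of [M], hence also each combination giving [G] at
   [lam (b', k)]. *)
under eq_bigr do rewrite E mulrDr mulr_sumr.
rewrite big_split /= exchange_big /= [X in X + _]big1 ?add0r => [|l _].
  have := congr1 (fun A : 'M[cplx R]_(1, 1) => A ord0 ord0) aM2; rewrite /= !mxE; apply: etrans.
  by apply: eq_bigr => j _; rewrite !mxE.
have := congr1 (fun A : 'rV_n => c (b', k) l * A 0 l) aM1; rewrite /= !mxE mulr0 mulr_sumr; apply: etrans.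
by apply: eq_bigr => j _; rewrite !mxE mulrCA.
Qed.
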